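(* Consider the data $(U_-,X,Y_-)$ and assume that $U_-$ has full row rank. Then $(U_-,X,Y_-)$ are informative for stabilization by dynamic measurement feedback if and only if the following conditions are satisfied: (i) We have $\operatorname{rank}\begin{bmatrix}X_- \\ U_- \end{bmatrix}=n+m$. Equivalently, there exists $\begin{bmatrix}V_1 & V_2\end{bmatrix}$ such that $$\begin{bmatrix}X_- \\ U_- \end{bmatrix}\begin{bmatrix}V_1 & V_2\end{bmatrix}=\begin{bmatrix}I & 0 \\ 0 & I\end{bmatrix}.$$ This means that $\Sigma_{i/s/o}=\{(X_+V_1,X_+V_2,Y_-V_1,Y_-V_2)\}$. (ii) The pair $(X_+V_1,X_+V_2)$ is stabilizable and $(Y_-V_1,X_+V_1)$ is detectable. Moreover, if conditions (i) and (ii) are satisfied, a stabilizing controller $(K,L,M)$ (that is, one with $\Sigma_{i/s/o}\subseteq\Sigma_{K,L,M}$) can be constructed as follows: (a) Select a matrix $M$ such that $X_+(V_1+V_2M)$ is stable. (b) Choose a matrix $L$ such that $(X_+-LY_-)V_1$ is stable. (c) Define $K:=(X_+-LY_-)(V_1+V_2M)$.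
   Context: Fix positive integers $n,m,p,q,T_1,\dots,T_q$. The 'true' system is $x(t+1)=A_sx(t)+B_su(t)$, $y(t)=C_sx(t)+D_su(t)$ with state in $\mathbb{R}^n$, input in $\mathbb{R}^m$, output in $\mathbb{R}^p$. For $i=1,\dots,q$, input/state/output data $u^i(t),y^i(t)$ ($t=0,\dots,T_i-1$) and $x^i(t)$ ($t=0,\dots,T_i$) generated by this system are collected. Put $U_-$, $Y_-$, $X_-$, $X_+$ equal to the matrices obtained by placing side by side, for $i=1,\dots,q$, the blocks $[u^i(0)\cdots u^i(T_i-1)]$, $[y^i(0)\cdots y^i(T_i-1)]$, $[x^i(0)\cdots x^i(T_i-1)]$, $[x^i(1)\cdots x^i(T_i)]$ respectively, and $X$ from the blocks $[x^i(0)\cdots x^i(T_i)]$. Hence $\begin{bmatrix}X_+ \\ Y_- \end{bmatrix}=\begin{bmatrix}A_s & B_s \\ C_s & D_s\end{bmatrix}\begin{bmatrix}X_- \\ U_- \end{bmatrix}$. The set of consistent systems is $$\Sigma_{i/s/o}=\Big\{(A,B,C,D)\ \Big|\ \begin{bmatrix}X_+ \\ Y_- \end{bmatrix}=\begin{bmatrix}A & B \\ C & D\end{bmatrix}\begin{bmatrix}X_- \\ U_- \end{bmatrix}\Big\}$$ (real matrices of sizes $n\times n$, $n\times m$, $p\times n$, $p\times m$). A dynamic controller is $w(t+1)=Kw(t)+Ly(t)$, $u(t)=Mw(t)$ with real matrices $K,L,M$ (any controller state dimension). A square matrix is stable if all its eigenvalues lie in the open unit disk; stabilizability of $(A,B)$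 (existence of $F$ with $A+BF$ stable) and detectability of $(C,A)$ (existence of $G$ with $A-GC$ stable) are in this discrete-time sense. For given $K,L,M$, $$\Sigma_{K,L,M}=\Big\{(A,B,C,D)\ \Big|\ \begin{bmatrix}A & BM \\ LC & K+LDM\end{bmatrix}\text{ is stable}\Big\}.$$ The data $(U_-,X,Y_-)$ are informative for stabilization by dynamic measurement feedback if there exist $K,L,M$ with $\Sigma_{i/s/o}\subseteq\Sigma_{K,L,M}$. *)

(* Defs.v *)
From mathcomp Require Import all_boot all_order all_algebra.
From mathcomp Require Import boolp classical_sets reals.
From mathcomp Require Import complex.

Set Implicit Arguments.
Unset Strict Implicit.
Unset Printing Implicit Defensive.

Import Order.TTheory GRing.Theory Num.Theory.

Local Open Scope classical_set_scope.
Local Open Scope ring_scope.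

(* Discrete-time stability. A is real, so its eigenvalues are those of its
   image in the complex matrices. *)
Definition stable (R : realType) (n : nat) (A : 'M[R]_n) : Prop :=
  forall z : R[i], eigenvalue (map_mx (real_complex R) A) z -> `|z| < 1.

Definition stabilizable (R : realType) (n m : nat)
    (A : 'M[R]_n) (B : 'M[R]_(n, m)) : Prop :=
  exists F : 'M[R]_(m, n), stable (A + B *m F).

Definition detectable (R : realType) (n p : nat)
    (C : 'M[R]_(p, n)) (A : 'M[R]_n) : Prop :=
  exists G : 'M[R]_(n, p), stable (A - G *m C).

Record system (R : realType) (n m p : nat) := System {
  sysA : 'M[R]_n;
  sysB : 'M[R]_(n, m);
  sysC : 'M[R]_(p, n);
  sysD : 'M[R]_(p, m)
}.

(* The i-th experiment has length T i. Column t of dataU i, dataX i, dataY i is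
   u^i(t), x^i(t), y^i(t); the state has one more sample than input and output. *)
Record data (R : realType) (n m p q : nat) (T : 'I_q -> nat) := Data {
  dataU : forall i, 'M[R]_(m, T i);
  dataX : forall i, 'M[R]_(n, (T i).+1);
  dataY : forall i, 'M[R]_(p, T i)
}.

Section DataMatrices.
Variables (R : realType) (n m p q : nat) (T : 'I_q -> nat).
Variable d : data R n m p T.

(* For t : 'I_(T i), the indices t and t+1 in 'I_(T i).+1. *)
Definition now (i : 'I_q) (t : 'I_(T i)) : 'I_(T i).+1 :=
  widen_ord (leqnSn (T i)) t.
Definition next (i : 'I_q) (t : 'I_(T i)) : 'I_(T i).+1 := lift ord0 t.

Definition generated_by (s : system R n m p) : Prop :=
  forall (i : 'I_q) (t : 'I_(T i)),
    col (next t) (dataX d i) =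
      sysA s *m col (now t) (dataX d i) + sysB s *m col t (dataU d i) /\
    col t (dataY d i) =
      sysC s *m col (now t) (dataX d i) + sysD s *m col t (dataU d i).

Definition Uminus : 'M[R]_(m, \sum_i T i) := \mxrow_i dataU d i.
Definition Yminus : 'M[R]_(p, \sum_i T i) := \mxrow_i dataY d i.
Definition Xminus : 'M[R]_(n, \sum_i T i) :=
  \mxrow_i colsub (@now i) (dataX d i).
Definition Xplus : 'M[R]_(n, \sum_i T i) :=
  \mxrow_i colsub (@next i) (dataX d i).

Definition Sigma_iso : set (system R n m p) :=
  [set s | col_mx Xplus Yminus =
           block_mx (sysA s) (sysB s) (sysC s) (sysD s) *m
             col_mx Xminus Uminus].

Definition Sigma_KLM (r : nat)
    (K : 'M[R]_r) (L : 'M[R]_(r, p)) (M : 'M[R]_(m, r)) :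
    set (system R n m p) :=
  [set s | stable (block_mx (sysA s)        (sysB s *m M)
                            (L *m sysC s)   (K + L *m sysD s *m M))].

Definition informative_dynamic_feedback : Prop :=
  exists (r : nat) (K : 'M[R]_r) (L : 'M[R]_(r, p)) (M : 'M[R]_(m, r)),
    Sigma_iso `<=` Sigma_KLM K L M.

Definition right_inverse_XU
    (V1 : 'M[R]_(\sum_i T i, n)) (V2 : 'M[R]_(\sum_i T i, m)) : Prop :=
  col_mx Xminus Uminus *m row_mx V1 V2 = block_mx 1%:M 0 0 1%:M.

End DataMatrices.

(* Main.v *)
(* Necessity of the rank condition: a left annihilator of the data yields a line
   of consistent systems along which the trace of the closed loop is unbounded,
   whereas a stable matrix has trace at most its size.  The data then determine
   the system, and stabilizability is read off a stable closed loop through the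
   Schur complement of one of its Lyapunov forms (detectability by transposing),
   which avoids the Hautus test and pole placement.  Lyapunov forms come from
   Schur triangularization.  Conversely, the stated controller is an observer
   combined with state feedback. *)
Require Import Defs.
From mathcomp Require Import all_boot all_order all_algebra.
From mathcomp Require Import boolp classical_sets reals.
From mathcomp Require Import complex ring lra.

Set Implicit Arguments.
Unset Strict Implicit.
Unset Printing Implicit Defensive.

Import Order.TTheory GRing.Theory Num.Theory.

Local Open Scope classical_set_scope.
Local Open Scope ring_scope.

(** * Real-valued squared modulus, and contraction estimates for triangular complex matrices *)

Section SquaredModulus.
Variable R : realType.
Implicit Types (x y z t : R[i]) (n : nat).

(** Takes values in [R] rather than [R[i]], so that the estimates below are real inequalities. *)
Definition sqmod z : R := complex.Re z ^+ 2 + complex.Im z ^+ 2.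

Lemma sqmod_ge0 z : 0 <= sqmod z.
Proof. by rewrite addr_ge0 ?sqr_ge0. Qed.

Lemma sqmod0 : sqmod 0 = 0.
Proof. by rewrite /sqmod /= expr0n addr0. Qed.

Lemma sqmod_gt0 z : z != 0 -> 0 < sqmod z.
Proof.
move=> z0; rewrite lt_neqAle sqmod_ge0 andbT eq_sym; apply: contraNneq z0.
by case: z => a b /eqP; rewrite /sqmod paddr_eq0 ?sqr_ge0 //= !sqrf_eq0
  eq_complex.
Qed.

Lemma sqmodM x y : sqmod (x * y) = sqmod x * sqmod y.
Proof. by case: x y => a b [c d]; rewrite /sqmod /=; ring. Qed.

Lemma sqmod_lt1 z : (`|z| < 1) = (sqmod z < 1).
Proof.
rewrite -(@expr_lt1 _ 2%N) // -add_Re2_Im2.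
by rewrite (_ : 1 = (1%:C)%C) // ltcR.
Qed.

(** Young's inequality: the right side minus the left is [sqmod (e x - y) / e]. *)
Lemma sqmodD_le (e : R) x y :
  0 < e -> sqmod (x + y) <= (1 + e) * sqmod x + (1 + e^-1) * sqmod y.
Proof.
move=> e_gt0; case: x y => a b [c d]; rewrite /sqmod /= -subr_ge0.
rewrite (_ : _ - _ = ((e * a - c) ^+ 2 + (e * b - d) ^+ 2) / e); last first.
  by field; rewrite gt_eqF.
by rewrite divr_ge0 ?(ltW e_gt0) // addr_ge0 ?sqr_ge0.
Qed.

(** A crude Cauchy-Schwarz bound: only the independence of [k] from [w] matters, so Young's
    inequality with [e = 1] is iterated. *)
Lemma sqmod_dot_le n (c : 'I_n -> R[i]) :
  exists2 k : R, 0 <= k & forall w : 'I_n -> R[i],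
    sqmod (\sum_i w i * c i) <= k * \sum_i sqmod (w i).
Proof.
elim: n c => [|n IHn] c.
  by exists 0 => // w; rewrite !big_ord0 sqmod0 mulr0.
have [k k_ge0 kP] := IHn (c \o lift ord0).
have c0 := sqmod_ge0 (c ord0).
exists (2 * sqmod (c ord0) + 2 * k) => [|w]; first by lra.
rewrite !big_ord_recl.
have := sqmodD_le (w ord0 * c ord0)
  (\sum_(i < n) w (lift ord0 i) * c (lift ord0 i)) (@ltr01 R).
have := kP (w \o lift ord0); rewrite sqmodM /= invr1 => le1 le2.
have w0 := sqmod_ge0 (w ord0).
have S0 : 0 <= \sum_(i < n) sqmod (w (lift ord0 i)).
  by apply: sumr_ge0 => i _; apply: sqmod_ge0.
set S := \sum_(i < n) sqmod _ in le1 S0 *.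
have := mulr_ge0 c0 S0; have := mulr_ge0 k_ge0 w0; nra.
Qed.

Lemma sqmod_contract t : sqmod t < 1 ->
  exists a b : R, [/\ 0 <= a, 0 <= b & forall x y,
    sqmod x + a * sqmod (x * t + y) <= a * sqmod x + b * sqmod y].
Proof.
set s := sqmod t => s_lt1; have s_ge0 : 0 <= s by apply: sqmod_ge0.
(* This choice gives [(1 + e) * s <= 1 - e]; the weight [e^-1] then turns the gain [e * sqmod x]
   into [sqmod x]. *)
pose e := (1 - s) / 2; have e_gt0 : 0 < e by rewrite /e; lra.
have eV := e_gt0; rewrite -invr_gt0 in eV.
exists e^-1, (e^-1 * (1 + e^-1)); split=> [||x y]; first exact: ltW.
  by rewrite mulr_ge0; lra.
have := sqmodD_le (x * t) y e_gt0; rewrite sqmodM -/s => le1.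
have le2 : sqmod (x * t + y) <= (1 - e) * sqmod x + (1 + e^-1) * sqmod y.
  apply: le_trans le1 _; rewrite lerD2r -subr_ge0.
  have -> : (1 - e) * sqmod x - (1 + e) * (sqmod x * s) =
            sqmod x * (1 - e - (1 + e) * s) by ring.
  by rewrite mulr_ge0 ?sqmod_ge0 // /e; nra.
have := ler_wpM2l (ltW eV) le2.
have -> : e^-1 * ((1 - e) * sqmod x + (1 + e^-1) * sqmod y) =
   e^-1 * sqmod x - sqmod x + e^-1 * (1 + e^-1) * sqmod y.
  by field; rewrite gt_eqF.
lra.
Qed.

(* Weighting the coordinates of a triangular contraction so that each one
   dominates the off-diagonal terms it receives. *)
Lemma trig_weights n (T : 'I_n -> 'I_n -> R[i]) :
  (forall i j : 'I_n, (i < j)%N -> T i j = 0) ->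
  (forall i, sqmod (T i i) < 1) ->
  exists2 d : 'I_n -> R, forall j, 0 <= d j & forall w : 'I_n -> R[i],
    \sum_i sqmod (w i) + \sum_j d j * sqmod (\sum_i w i * T i j) <=
    \sum_j d j * sqmod (w j).
Proof.
elim: n T => [|n IHn] T T_trig T_lt1.
  by exists (fun=> 0) => // w; rewrite !big_ord0 addr0.
have [||d d_ge0 dP] := IHn (fun i j => T (lift ord0 i) (lift ord0 j)).
- by move=> i j lt_ij; apply: T_trig; rewrite !lift0 ltnS.
- by move=> i; apply: T_lt1.
have [a [b [a_ge0 b_ge0 abP]]] := sqmod_contract (T_lt1 ord0).
have [k k_ge0 kP] := sqmod_dot_le (fun i => T (lift ord0 i) ord0).
have K_ge0 : 0 <= 1 + b * k by rewrite addr_ge0 ?mulr_ge0.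
(* Only column 0 mixes the new coordinate with the others. In the factor [1 + b * k], the 1 yields
   their [sqmod] sum and [b * k] pays for their contribution to that column. *)
exists (fun i => if unlift ord0 i is Some j then (1 + b * k) * d j else a)
  => [j|w].
  by case: unliftP => // i _; rewrite mulr_ge0.
rewrite !big_ord_recl !unlift_none.
have := dP (w \o lift ord0); have := kP (w \o lift ord0) => /=.
have := abP (w ord0) (\sum_(i < n) w (lift ord0 i) * T (lift ord0 i) ord0).
have dE (f : 'I_n -> R) : \sum_(j < n)
    (if unlift ord0 (lift ord0 j) is Some j then (1 + b * k) * d j else a) * f j
    = (1 + b * k) * \sum_j d j * f j.
  by rewrite mulr_sumr; apply: eq_bigr => j _; rewrite liftK mulrA.
have TE : \sum_j d j * sqmod (\sum_i w i * T i (lift ord0 j)) = \sum_j d j *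
    sqmod (\sum_i w (lift ord0 i) * T (lift ord0 i) (lift ord0 j)).
  apply: eq_bigr => j _.
  by rewrite big_ord_recl (T_trig ord0) ?lift0 // mulr0 add0r.
rewrite !dE TE.
set y := \sum_(i < n) w _ * _; set S := \sum_(i < n) sqmod (w _).
set D1 := \sum_(j < n) _ * _; set D2 := \sum_(j < n) _ * _.
move=> le1 le2 le3; have := ler_wpM2l b_ge0 le2.
have := ler_wpM2l K_ge0 le3.
have -> : (1 + b * k) * (S + D1) = S + b * (k * S) + (1 + b * k) * D1 by ring.
lra.
Qed.

End SquaredModulus.

(** * Stable real matrices: triangularization, Lyapunov forms, feedback and observers *)

Section StableMatrices.
Variable R : realType.
Implicit Types (n m r : nat).

Local Notation toC := (map_mx (real_complex R)).

Lemma stable_trig n (A : 'M[R]_n) : stable A ->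
  exists S T : 'M[R[i]]_n, [/\ S \in unitmx, is_trig_mx T,
    toC A = invmx S *m T *m S & forall i, sqmod (T i i) < 1].
Proof.
move=> stA; have [|S /unitarymx_unit Su] := @cotrigonalization _ _ [:: toC A].
  by move=> B B'; rewrite !inE => /eqP-> /eqP->.
rewrite /= andbT /similar_to => trigT; set T := conjmx S (toC A) in trigT.
have ST : T = S *m toC A *m invmx S by rewrite /T conjumx.
exists S, T; split=> // [|i].
  by rewrite ST !mulmxA mulVmx // mul1mx mulmxKV.
(* Similarity preserves the characteristic polynomial, so each diagonal entry of [T] is an
   eigenvalue of [A]. *)
rewrite -sqmod_lt1; apply: stA; rewrite eigenvalue_root_char.
have <- : char_poly T = char_poly (toC A).
  have SV : map_mx polyC S *m map_mx polyC (invmx S) = 1%:M.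
    by rewrite -map_mxM mulmxV // map_mx1.
  rewrite ST /char_poly /char_poly_mx !map_mxM /=.
  have -> : 'X%:M - map_mx polyC S *m map_mx polyC (toC A) *m
      map_mx polyC (invmx S) = map_mx polyC S *m ('X%:M - map_mx polyC (toC A)) *m
      map_mx polyC (invmx S).
    by rewrite mulmxBr mulmxBl scalar_mxC -['X%:M *m _ *m _]mulmxA SV mulmx1.
  by rewrite !det_mulmx mulrAC -det_mulmx SV det1 mul1r.
rewrite char_poly_trig // /root horner_prod (bigD1 i) //=.
by rewrite hornerXsubC subrr mul0r.
Qed.

(** The trace is the sum of the real parts of the diagonal entries of a triangular form, each of
    modulus below 1. *)
Lemma stable_mxtrace n (A : 'M[R]_n) : stable A -> \tr A <= n%:R.
Proof.
move=> /stable_trig[S [T [Su _ AE T_lt1]]].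
have trE : (\tr A)%:C%C = \sum_i T i i.
  rewrite -[RHS]/(\tr T) -[T](mulKVmx Su) mxtrace_mulC -AE.
  by rewrite /mxtrace rmorph_sum; apply: eq_bigr => i _; rewrite mxE.
have -> : \tr A = \sum_i complex.Re (T i i).
  by rewrite -(raddf_sum (@complex.Re R : Rcomplex R -> R)) -trE.
rewrite -[X in X%:R](card_ord n) -sumr_const; apply: ler_sum => i _.
have := T_lt1 i; rewrite /sqmod; have := sqr_ge0 (complex.Im (T i i)); nra.
Qed.

Lemma stable_trmx n (A : 'M[R]_n) : stable A -> stable A^T.
Proof.
move=> stA z; rewrite eigenvalue_root_char -map_trmx => zA; apply: stA.
rewrite eigenvalue_root_char; suff <- : char_poly (toC A)^T = char_poly (toC A).
  by [].
rewrite /char_poly -det_tr; congr (\det _); apply/matrixP => i j.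
by rewrite !mxE eq_sym.
Qed.

(** Row vectors are used because [eigenvalue] refers to left eigenvectors; the dynamics act as
    [v *m A]. *)
Definition qform n (P : 'M[R]_n) (v : 'rV_n) : R := (v *m P *m v^T) 0 0.

Local Notation re := (map_mx (@complex.Re R)).
Local Notation im := (map_mx (@complex.Im R)).

Lemma mulmx_re_r m n r (V : 'M[R[i]]_(m, n)) (A : 'M[R]_(n, r)) :
  re (V *m toC A) = re V *m A.
Proof.
apply/matrixP => i j; rewrite !mxE (raddf_sum (@complex.Re R : Rcomplex R -> R)).
by apply: eq_bigr => k _; rewrite !mxE; case: (V i k) => a b /=; ring.
Qed.

Lemma mulmx_im_r m n r (V : 'M[R[i]]_(m, n)) (A : 'M[R]_(n, r)) :
  im (V *m toC A) = im V *m A.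
Proof.
apply/matrixP => i j; rewrite !mxE (raddf_sum (@complex.Im R : Rcomplex R -> R)).
by apply: eq_bigr => k _; rewrite !mxE; case: (V i k) => a b /=; ring.
Qed.

Lemma mulmx_re_l m n r (A : 'M[R]_(m, n)) (V : 'M[R[i]]_(n, r)) :
  re (toC A *m V) = A *m re V.
Proof.
by apply: trmx_inj; rewrite !(map_trmx, trmx_mul) mulmx_re_r.
Qed.

Lemma mulmx_im_l m n r (A : 'M[R]_(m, n)) (V : 'M[R[i]]_(n, r)) :
  im (toC A *m V) = A *m im V.
Proof.
by apply: trmx_inj; rewrite !(map_trmx, trmx_mul) mulmx_im_r.
Qed.

Lemma qform_comb n (P : 'M[R]_n) (a b : R) (u v : 'rV_n) :
  qform P (a *: u + b *: v) = a ^+ 2 * qform P u + b ^+ 2 * qform P v +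
    a * b * ((u *m P *m v^T) 0 0 + (v *m P *m u^T) 0 0).
Proof.
rewrite /qform linearD /= !linearZ /= !mulmxDl !mulmxDr.
rewrite -!scalemxAl -!scalemxAr; set X := u *m P *m v^T.
set Y := v *m P *m u^T; set U := u *m P *m u^T; set V := v *m P *m v^T.
by rewrite !mxE; ring.
Qed.

Lemma qform_diag n m (d : 'rV[R]_n) (Q : 'M[R]_(m, n)) v :
  qform (Q *m diag_mx d *m Q^T) v = \sum_j d 0 j * (v *m Q) 0 j ^+ 2.
Proof.
rewrite /qform (_ : _ *m v^T = (v *m Q) *m diag_mx d *m (v *m Q)^T); last first.
  by rewrite trmx_mul !mulmxA.
rewrite mul_mx_diag mxE; apply: eq_bigr => j _; rewrite !mxE; ring.
Qed.

(** The weights found for the triangular form are pulled back along [invmx S]; the surplus [sqmod]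
    sum in [trig_weights] makes the decrease strict. *)
Lemma lyapunov n (A : 'M[R]_n) : stable A ->
  exists P : 'M[R]_n, [/\ P^T = P, forall v, v != 0 -> 0 < qform P v &
    forall v, v != 0 -> qform P (v *m A) < qform P v].
Proof.
move=> /stable_trig[S [T [Su /is_trig_mxP trigT AE T_lt1]]].
have [d d_ge0 dP] := trig_weights trigT T_lt1.
set Q := invmx S; set D := diag_mx (\row_j d j).
(* The real part of the Hermitian matrix [Q D Q^*]: on real vectors both define the same form. *)
exists (re Q *m D *m (re Q)^T + im Q *m D *m (im Q)^T).
set P := _ + _; pose w (v : 'rV_n) : 'rV_n := toC v *m Q.
have qE v : qform P v = \sum_j d j * sqmod (w v 0 j).
  rewrite /qform mulmxDr mulmxDl mxE -!/(qform _ v) !qform_diag -big_split.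
  apply: eq_bigr => j _.
  by rewrite /= -mulmx_re_l -mulmx_im_l -/(w v) -mulrDr !mxE.
have wA v j : w (v *m A) 0 j = \sum_i w v 0 i * T i j.
  by rewrite /w map_mxM /= AE !mulmxA mulmxK // mxE.
have w_gt0 v : v != 0 -> 0 < \sum_i sqmod (w v 0 i).
  move=> v0; have /rV0Pn[j wj] : w v != 0.
    apply: contraNneq v0 => wv0; apply/eqP.
    apply: (@map_mx_inj _ _ (real_complex R)).
    by rewrite -[LHS](mulmxKV Su) -/(w v) wv0 mul0mx map_mx0.
  rewrite (bigD1 j) //= ltr_pwDl ?sqmod_gt0 //.
  by apply: sumr_ge0 => i _; apply: sqmod_ge0.
split=> [|v v0|v v0].
- by rewrite linearD /= !trmx_mul !trmxK tr_diag_mx !mulmxA.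
- apply: lt_le_trans (w_gt0 v v0) _; rewrite qE.
  apply: le_trans (dP (w v 0)); rewrite lerDl.
  by apply: sumr_ge0 => j _; rewrite mulr_ge0 ?sqmod_ge0.
rewrite !qE; apply: lt_le_trans (dP (w v 0)).
by under eq_bigr do rewrite wA; rewrite ltrDr w_gt0.
Qed.

(** For a left eigenvector, the forms at its real and imaginary parts have a sum that [A] multiplies
    by [sqmod z] and yet strictly decreases, one part being nonzero. *)
Lemma lyapunov_stable n (A P : 'M[R]_n) :
  (forall v, v != 0 -> 0 < qform P v) ->
  (forall v, v != 0 -> qform P (v *m A) < qform P v) -> stable A.
Proof.
move=> P_gt0 P_dec z /eigenvalueP[v vA v0]; rewrite sqmod_lt1.
set x := re v; set y := im v.
have q0 : qform P 0 = 0 by rewrite /qform !mul0mx mxE.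
have xA : x *m A = complex.Re z *: x - complex.Im z *: y.
  rewrite -mulmx_re_r vA; apply/rowP => j; rewrite !mxE.
  by case: z {vA} (v 0 j) => a b [].
have yA : y *m A = complex.Re z *: y + complex.Im z *: x.
  rewrite -mulmx_im_r vA; apply/rowP => j; rewrite !mxE.
  by case: z {vA xA} (v 0 j) => a b [] /= c e; ring.
(* The cross terms of the two expansions are opposite and cancel. *)
have qz : qform P (x *m A) + qform P (y *m A) =
    sqmod z * (qform P x + qform P y).
  rewrite xA yA -scaleNr [_ *: y + _]addrC !qform_comb /sqmod; ring.
have dec_le u : qform P (u *m A) <= qform P u.
  by have [->|/P_dec/ltW//] := eqVneq u 0; rewrite mul0mx.
have ge0 u : 0 <= qform P u by have [->|/P_gt0/ltW//] := eqVneq u 0; rewrite q0.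
have [x0|x0] := eqVneq x 0; last first.
  have := P_gt0 x x0; have := P_dec x x0; have := dec_le y; have := ge0 y; nra.
have y0 : y != 0.
  apply: contraNneq v0 => y0; apply/eqP/rowP => j; apply/eqP.
  move/rowP/(_ j): x0; move/rowP/(_ j): y0; rewrite !mxE eq_complex => -> ->.
  by rewrite eqxx.
have := P_gt0 y y0; have := P_dec y y0; have := dec_le x; have := ge0 x; nra.
Qed.

(* Schur complement of a Lyapunov form for the closed loop: minimizing it over
   the second block leaves a Lyapunov form for the feedback [M P21 P11^-1]. *)
Lemma stable_block_stabilizable n m r (A : 'M[R]_n) (B : 'M[R]_(n, m))
    (M : 'M[R]_(m, r)) (G : 'M[R]_(r, n)) (H : 'M[R]_r) :
  stable (block_mx A (B *m M) G H) -> stabilizable A B.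
Proof.
move=> /lyapunov[P [P_sym P_gt0 P_dec]].
set P11 := ulsubmx P; set P21 := dlsubmx P;
  set P22 := drsubmx P.
have P11_sym : P11^T = P11 by rewrite trmx_ulsub P_sym.
have q11 u : qform P (row_mx u 0) = qform P11 u.
  rewrite /qform -[P]submxK mul_row_block !mul0mx !addr0 tr_row_mx mul_row_col.
  by rewrite trmx0 mulmx0 addr0.
have row_neq0 (u : 'rV[R]_n) : u != 0 -> row_mx u (0 : 'rV[R]_r) != 0.
  by apply: contraNneq => /eqP; rewrite row_mx_eq0 => /andP[].
have P11u : P11 \in unitmx.
  rewrite -row_free_unit; apply: inj_row_free => u uP; apply/eqP.
  by apply: contraT => /row_neq0/P_gt0; rewrite q11 /qform uP mul0mx mxE ltxx.
have [X XP] : exists X, P21 = X *m P11.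
  by exists (P21 *m invmx P11); rewrite mulmxKV.
have PE : P = block_mx P11 (P11 *m X^T) (X *m P11) P22.
  have -> : P11 *m X^T = P21^T by rewrite XP trmx_mul P11_sym.
  by rewrite -XP trmx_dlsub P_sym submxK.
(* Completing the square in [a]; the last term is a value of [P], hence nonnegative. *)
have schur (a : 'rV_n) (b : 'rV_r) : qform P (row_mx a b) =
    qform P11 (a + b *m X) + qform P (row_mx (- (b *m X)) b).
  rewrite /qform PE !mul_row_block !tr_row_mx !mul_row_col.
  rewrite [(a + _)^T]linearD [(- (b *m X))^T]linearN /= trmx_mul.
  rewrite !(mulmxDl, mulmxDr, mulNmx, mulmxN) /= !mulmxA.
  set u1 := a *m P11 *m a^T; set u2 := b *m X *m P11 *m a^T.
  set u3 := a *m P11 *m X^T *m b^T; set u4 := b *m X *m P11 *m X^T *m b^T.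
  by set u5 := b *m P22 *m b^T; rewrite !mxE; ring.
exists (M *m X); apply: (@lyapunov_stable _ _ P11) => v v0.
  by rewrite -q11; apply/P_gt0/row_neq0.
(* The closed loop sends [(v, 0)] to [(v A, v B M)], whose form dominates that of [P11] at
   [v (A + B M X)]. *)
have := P_dec _ (row_neq0 _ v0); rewrite q11; apply: le_lt_trans.
rewrite mul_row_block !mul0mx !addr0 schur mulmxDr !mulmxA lerDl.
have [->|/P_gt0/ltW//] := eqVneq (row_mx (- (v *m B *m M *m X)) (v *m B *m M)) 0.
by rewrite /qform !mul0mx mxE.
Qed.

(** Duality: transposition turns [L *m C] into a feedback term [C^T *m L^T]. *)
Lemma stable_block_detectable n p r (A : 'M[R]_n) (C : 'M[R]_(p, n))
    (L : 'M[R]_(r, p)) (G : 'M[R]_(n, r)) (H : 'M[R]_r) :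
  stable (block_mx A G (L *m C) H) -> detectable C A.
Proof.
move/stable_trmx; rewrite tr_block_mx trmx_mul => /stable_block_stabilizable[F].
move/stable_trmx; rewrite linearD /= trmx_mul !trmxK => stF.
by exists (- F^T); rewrite mulNmx opprK.
Qed.

(* With estimation error [e := x - w], the closed loop is block triangular with
   diagonal blocks [A + B M] and [A - L C]. *)
Lemma observer_stable n m p (A : 'M[R]_n) (B : 'M[R]_(n, m)) (C : 'M[R]_(p, n))
    (L : 'M[R]_(n, p)) (M : 'M[R]_(m, n)) :
  stable (A + B *m M) -> stable (A - L *m C) ->
  stable (block_mx A (B *m M) (L *m C) (A + B *m M - L *m C)).
Proof.
move=> stF stG z /eigenvalueP[v]; rewrite -[v]hsubmxK map_block_mx.
set x := lsubmx v; set y := rsubmx v.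
rewrite mul_row_block scale_row_mx => /eq_row_mx[eqx eqy] v0.
(* Adding the two block equations cancels [L C]. If [x + y] vanishes, [y] is instead an eigenvector
   of [A - L C]. *)
have eqs : (x + y) *m toC (A + B *m M) = z *: (x + y).
  rewrite scalerDr -eqx -eqy map_mxB !map_mxD /= !(mulmxDl, mulmxDr, mulmxN).
  move: (x *m _) (x *m _) (y *m _) (y *m _) (y *m _) => a b c e f.
  by apply/rowP => j; rewrite !mxE; ring.
have [s0|s0] := eqVneq (x + y) 0; last first.
  by apply: stF; apply/eigenvalueP; exists (x + y).
have xE : x = - y by apply/eqP; rewrite -addr_eq0 s0.
apply: stG; apply/eigenvalueP; exists y; last first.
  by apply: contraNneq v0 => y0; rewrite xE y0 oppr0 row_mx0.
apply: oppr_inj; rewrite -scalerN -xE -eqx xE map_mxB /=.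
by rewrite mulmxBr mulNmx opprB addrC.
Qed.

End StableMatrices.

(** * Data matrices and the set of consistent systems *)

Section DataDriven.
Variables (R : realType) (n m p q : nat) (T : 'I_q -> nat).
Variable d : data R n m p T.
Implicit Types (s : system R n m p).

(** Collects samplewise equations into one matrix identity, for both the state and the output
    equation. *)
Lemma mxrow_linear_data k (A : 'M[R]_(k, n)) (B : 'M[R]_(k, m))
    (Z : forall i, 'M[R]_(k, T i)) :
  (forall i (t : 'I_(T i)),
    col t (Z i) = A *m col (now t) (dataX d i) + B *m col t (dataU d i)) ->
  \mxrow_i Z i = A *m Xminus d + B *m Uminus d.
Proof.
move=> ZE; rewrite /Xminus /Uminus !mul_mxrow -mxrowD; apply: eq_mxrow => i.
apply/matrixP => j t; have /colP/(_ j) := ZE i t; rewrite !mxE => ->.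
by congr (_ + _); apply: eq_bigr => l _; rewrite !mxE.
Qed.

Lemma generated_Sigma_iso s : generated_by d s -> Sigma_iso d s.
Proof.
move=> gen; rewrite /Sigma_iso /= mul_block_col; congr col_mx.
  apply: mxrow_linear_data => i t; rewrite -(proj1 (gen i t)).
  by apply/colP => j; rewrite !mxE.
by apply: mxrow_linear_data => i t; case: (gen i t).
Qed.

Lemma rank_right_inverse :
  \rank (col_mx (Xminus d) (Uminus d)) = (n + m)%N <->
  exists V1 V2, right_inverse_XU d V1 V2.
Proof.
rewrite /right_inverse_XU -scalar_mx_block; split=> [/eqP/row_freeP[V VE]|].
  by exists (lsubmx V), (rsubmx V); rewrite hsubmxK.
by move=> [V1 [V2 VE]]; apply/eqP/row_freeP; exists (row_mx V1 V2).
Qed.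

Lemma Sigma_iso_right_inverse s V1 V2 :
  Sigma_iso d s -> right_inverse_XU d V1 V2 ->
  s = System (Xplus d *m V1) (Xplus d *m V2) (Yminus d *m V1) (Yminus d *m V2).
Proof.
case: s => A B C D; rewrite /Sigma_iso /right_inverse_XU /= => dE VE.
have : col_mx (Xplus d) (Yminus d) *m row_mx V1 V2 = block_mx A B C D.
  by rewrite dE -mulmxA VE -scalar_mx_block mulmx1.
by rewrite mul_col_row => /eq_block_mx[-> -> -> ->].
Qed.

(* A left annihilator [xi, eta] of the data, with [xi != 0] since [U] has full
   rank, lets one add [t xi^T xi] to [A], which makes the trace of the closed
   loop unbounded. *)
Lemma informative_rank s : row_free (Uminus d) -> Sigma_iso d s ->
  informative_dynamic_feedback d ->
  \rank (col_mx (Xminus d) (Uminus d)) = (n + m)%N.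
Proof.
case: s => A B C D U_free sys [r [K [L [M KLM]]]].
apply/eqP; apply: inj_row_free => v.
rewrite -[v]hsubmxK mul_row_col; set xi := lsubmx v; set eta := rsubmx v => v0.
have [xi0|xi0] := eqVneq xi 0.
  move: v0; rewrite xi0 mul0mx add0r => /eqP; rewrite mulmx_free_eq0 // => /eqP->.
  by rewrite row_mx0.
pose N := xi^T *m xi; pose N' := xi^T *m eta.
have N_gt0 : 0 < \tr N.
  have /rV0Pn[j xij] := xi0.
  rewrite mxtrace_mulC /mxtrace big_ord1 mxE (bigD1 j) //= [xi^T _ _]mxE.
  rewrite ltr_pwDl //; first by rewrite -expr2 exprn_even_gt0.
  by apply: sumr_ge0 => i _; rewrite [xi^T _ _]mxE -expr2 sqr_ge0.
(* The change [[t N, t N']] is [t xi^T v], which annihilates the data. Keeping [C] and [D] fixes the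
   lower diagonal block of the closed loop. *)
have bound t : \tr A + t * \tr N + \tr (K + L *m D *m M) <= (n + r)%:R.
  have /KLM /stable_mxtrace : Sigma_iso d (System (A + t *: N) (B + t *: N') C D).
    move: sys; rewrite /Sigma_iso /= !mul_block_col => ->; congr col_mx.
    rewrite !mulmxDl -!scalemxAl -!mulmxA addrACA -scalerDr -mulmxDr v0.
    by rewrite mulmx0 scaler0 addr0.
  by rewrite /= mxtrace_block mxtraceD mxtraceZ.
(* At this [t] the left side of [bound] equals [(n + r)%:R + 1]. *)
exfalso; have := bound (((n + r)%:R + 1 - \tr A - \tr (K + L *m D *m M)) / \tr N).
rewrite divfK ?gt_eqF //; lra.
Qed.

End DataDriven.

Theorem theorem34 (R : realType) (n m p q : nat) (T : 'I_q -> nat)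
    (n_gt0 : (0 < n)%N) (m_gt0 : (0 < m)%N) (p_gt0 : (0 < p)%N)
    (q_gt0 : (0 < q)%N) (T_gt0 : forall i, (0 < T i)%N)
    (true_sys : system R n m p) (d : data R n m p T)
    (d_gen : generated_by d true_sys)
    (U_full : row_free (Uminus d)) :
  [/\ informative_dynamic_feedback d <->
        \rank (col_mx (Xminus d) (Uminus d)) = (n + m)%N /\
        exists V1 V2,
          [/\ right_inverse_XU d V1 V2,
              stabilizable (Xplus d *m V1) (Xplus d *m V2) &
              detectable (Yminus d *m V1) (Xplus d *m V1)],
      \rank (col_mx (Xminus d) (Uminus d)) = (n + m)%N <->
        exists V1 V2, right_inverse_XU d V1 V2,
      forall V1 V2, right_inverse_XU d V1 V2 ->
        Sigma_iso d =
          [set System (Xplus d *m V1) (Xplus d *m V2)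
                      (Yminus d *m V1) (Yminus d *m V2)] &
      forall V1 V2, right_inverse_XU d V1 V2 ->
        stabilizable (Xplus d *m V1) (Xplus d *m V2) ->
        detectable (Yminus d *m V1) (Xplus d *m V1) ->
        [/\ exists M : 'M[R]_(m, n), stable (Xplus d *m (V1 + V2 *m M)),
            exists L : 'M[R]_(n, p), stable ((Xplus d - L *m Yminus d) *m V1) &
            forall (M : 'M[R]_(m, n)) (L : 'M[R]_(n, p)),
              stable (Xplus d *m (V1 + V2 *m M)) ->
              stable ((Xplus d - L *m Yminus d) *m V1) ->
              Sigma_iso d `<=`
                Sigma_KLM ((Xplus d - L *m Yminus d) *m (V1 + V2 *m M)) L M]].
Proof.
have true_in : Sigma_iso d true_sys by apply: generated_Sigma_iso.
have SigmaE V1 V2 : right_inverse_XU d V1 V2 ->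
    Sigma_iso d = [set System (Xplus d *m V1) (Xplus d *m V2)
                              (Yminus d *m V1) (Yminus d *m V2)].
  move=> VE; apply/seteqP; split=> s /=.
    by move=> sys; apply: Sigma_iso_right_inverse.
  (* The true system is consistent, so the system computed from the data is the true one and lies in
     the set. *)
  by move->; rewrite -(Sigma_iso_right_inverse true_in VE).
have controller V1 V2 (M : 'M[R]_(m, n)) (L : 'M[R]_(n, p)) :
    right_inverse_XU d V1 V2 ->
    stable (Xplus d *m (V1 + V2 *m M)) ->
    stable ((Xplus d - L *m Yminus d) *m V1) ->
    Sigma_iso d `<=`
      Sigma_KLM ((Xplus d - L *m Yminus d) *m (V1 + V2 *m M)) L M.
  move=> VE; rewrite mulmxDr mulmxBl !mulmxA -!(mulmxA L) => stM stL.
  rewrite (SigmaE _ _ VE) => _ ->; rewrite /Sigma_KLM /=.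
  (* The term [- L D M] inside [K] cancels [L D M] in the closed loop, leaving the observer block
     [A + B M - L C]. *)
  have := observer_stable stM stL; congr (stable (block_mx _ _ _ _)).
  by rewrite mulmxDr !mulmxBl !mulmxA addrA subrK addrAC.
split.
- split=> [inf|[_ [V1 [V2 [VE [F stF] [G stG]]]]]]; last first.
    exists n, ((Xplus d - G *m Yminus d) *m (V1 + V2 *m F)), G, F.
    have stF' : stable (Xplus d *m (V1 + V2 *m F)).
      rewrite mulmxDr mulmxA; exact: stF.
    have stG' : stable ((Xplus d - G *m Yminus d) *m V1).
      rewrite mulmxBl -mulmxA; exact: stG.
    exact: controller VE stF' stG'.
  have rk := informative_rank U_full true_in inf; split; first by [].
  have [V1 [V2 VE]] := proj1 (rank_right_inverse d) rk.
  exists V1, V2; have [r [K [L [M KLM]]]] := inf.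
  (* Stability of this single closed loop gives both stabilizability and detectability. *)
  have /KLM := true_in; rewrite (Sigma_iso_right_inverse true_in VE) => st.
  split; first by [].
    exact: stable_block_stabilizable st.
  exact: stable_block_detectable st.
- exact: rank_right_inverse.
- exact: SigmaE.
move=> V1 V2 VE [F stF] [G stG]; split=> [||M L]; last exact: controller.
  exists F; rewrite mulmxDr mulmxA; exact: stF.
exists G; rewrite mulmxBl -mulmxA; exact: stG.
Qed.
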